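(* Let $(X,d)$ be a metric space and let $\mathcal{S}$ be a bornology on $X$. Then the following statements are equivalent: (i) $X$ is $\mathcal{S}$-separable; (ii) $(CL(X),\tau_{\mathcal{S},d})$ is submetrizable; (iii) $(CL(X),\tau_{\mathcal{S},d})$ has a $G_{\delta}$-diagonal; (iv) each point of $(CL(X),\tau_{\mathcal{S},d})$ is a $G_{\delta}$-set.
   Context: For a metric space $(X,d)$, $\mathcal{P}_0(X)$ is the set of all nonempty subsets of $X$ and $CL(X)$ is the set of all nonempty closed subsets. A bornology on $X$ is a family $\mathcal{S}\subseteq\mathcal{P}_0(X)$ that is closed under finite unions and under taking (nonempty) subsets and covers $X$. For $x\in X$ and $A\in\mathcal{P}_0(X)$, $d(x,A)=\inf\{d(x,a):a\in A\}$. The topology $\tau_{\mathcal{S},d}$ on $CL(X)$ is the one induced by the uniformity $\mathcal{U}_{\mathcal{S},d}$ having as a base the sets $[S,\epsilon]=\{(A,C): \sup_{x\in S}|d(x,A)-d(x,C)|<\epsilon\}$, $S\in\mathcal{S}$, $\epsilon>0$; thus a net $(A_\lambda)$ converges to $A$ iff $d(\cdot,A_\lambda)\to d(\cdot,A)$ uniformly on each member of $\mathcal{S}$. $X$ is called $\mathcal{S}$-separable if there is a countable subcollection $\{S_n:n\in\mathbb{N}\}$ of $\mathcal{S}$ with $X=\overline{\bigcup_{n\in\mathbb{N}}S_n}$. A topological space is submetrizable if it admits a weaker (coarser, not necessarily strictly) metrizable topology; a space $Y$ has a $G_\delta$-diagonal if $\{(y,y):y\in Y\}$ is a $G_\delta$-set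 in $Y\times Y$. *)

(* Defs.v *)
From HB Require Import structures.
From mathcomp Require Import all_boot all_order all_algebra.
From mathcomp Require Import all_classical all_reals all_analysis.
From mathcomp Require Export borel_hierarchy.

Set Implicit Arguments.
Unset Strict Implicit.
Unset Printing Implicit Defensive.

Import Order.TTheory GRing.Theory Num.Theory.

Local Open Scope classical_set_scope.
Local Open Scope ring_scope.

Record bornology (X : Type) (S : set (set X)) : Prop := {
  bornology_nonempty : forall A, S A -> A !=set0;
  bornology_setU : forall A B, S A -> S B -> S (A `|` B);
  bornology_sub : forall A B, S A -> B `<=` A -> B !=set0 -> S B;
  bornology_cover : \bigcup_(A in S) A = setT
}.

Record CL (X : topologicalType) := {
  CL_set :> set X;
  CL_nonempty : CL_set !=set0;
  CL_closed : closed CL_set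
}.

Section distance.
Context {R : realType} {X : metricType R}.

Definition dist_set (x : X) (A : set X) : R := inf [set mdist x a | a in A].

(* The supremum is taken in the extended reals, as it may be infinite. *)
Definition bornology_entourage (S : set X) (eps : R) : set (CL X * CL X) :=
  [set AC : CL X * CL X |
    (ereal_sup [set `|dist_set x AC.1 - dist_set x AC.2|%:E | x in S]
     < eps%:E)%E].

Definition bornology_base (S : set (set X)) : set (set (CL X * CL X)) :=
  [set E | exists A eps, [/\ S A, 0 < eps & E = bornology_entourage A eps]].

(* Taking the generated filter instead of the supersets of members of the base
   makes a difference only for the empty space, whose base is empty: see
   [uniformity_of_bornologyP] below. *)
Definition uniformity_of_bornology (S : set (set X)) :
    set_system (CL X * CL X) := smallest Filter (bornology_base S).

End distance.

(* CL(X) equipped with the uniformity and the topology of the bornology S. *)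
Definition CLtau (R : realType) (X : metricType R) (S : set (set X))
  (bS : bornology S) : Type := CL X.

Section uniform.
Context {R : realType} {X : metricType R}.
Implicit Types (S : set (set X)) (A B : set X).

Local Lemma entourage_le A eps (p : CL X * CL X) x :
  bornology_entourage A eps p -> A x ->
  `|dist_set x p.1 - dist_set x p.2| < eps.
Proof.
move=> h Ax; rewrite -lte_fin; apply: le_lt_trans h.
by apply: ereal_sup_ubound; exists x.
Qed.

Local Lemma entourage_lt A eps eps' (p : CL X * CL X) : eps' < eps ->
  (forall x, A x -> `|dist_set x p.1 - dist_set x p.2| <= eps') ->
  bornology_entourage A eps p.
Proof.
move=> lte h; rewrite /bornology_entourage /=.
apply: (@le_lt_trans _ _ eps'%:E); last by rewrite lte_fin.
by apply: ge_ereal_sup => _ [x Ax <-]; rewrite lee_fin h.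
Qed.

Local Lemma entourageS A B eps eps' : A `<=` B -> eps <= eps' ->
  bornology_entourage B eps `<=` bornology_entourage A eps'.
Proof.
move=> AB ee p; rewrite /bornology_entourage /= => h.
apply: (@lt_le_trans _ _ eps%:E); last by rewrite lee_fin.
apply: le_lt_trans h; apply: ereal_sup_le => _ [x Ax <-]; exists x => //.
exact: AB.
Qed.

Lemma uniformity_of_bornologyE S : bornology S ->
  uniformity_of_bornology S = [set E | E = setT \/
    exists A eps, [/\ S A, 0 < eps & bornology_entourage A eps `<=` E]].
Proof.
move=> bS; apply/seteqP; split => [|E].
  apply: smallest_sub; last first.
    by move=> E [A [e [SA e0 ->]]]; right; exists A, e; split.
  split; first by left.
  - move=> P Q [->|[A [e [SA e0 AP]]]]; first by rewrite setTI.
    move=> [->|[B [f [SB f0 BQ]]]]; first by rewrite setIT; right; exists A, e.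
    right; exists (A `|` B), (Num.min e f); split.
    + exact: bornology_setU.
    + by rewrite lt_min e0.
    + move=> p h; split.
        apply: AP; apply: entourageS h; first exact: subsetUl.
        by rewrite ge_min lexx.
      apply: BQ; apply: entourageS h; first exact: subsetUr.
      by rewrite ge_min lexx orbT.
  - move=> P Q PQ [PT|[A [e [SA e0 AP]]]].
      by left; apply/seteqP; split => // p _; apply: PQ; rewrite PT.
    by right; exists A, e; split => //; exact: subset_trans PQ.
move=> [->|[A [e [SA e0 AE]]]]; first exact: filterT.
have FS : Filter (uniformity_of_bornology S) by exact: smallest_filter_filter.
by apply: (@filterS _ _ FS _ _ AE); apply: sub_gen_smallest; exists A, e.
Qed.

Lemma uniformity_of_bornologyP S : bornology S -> [set: X] !=set0 ->
  uniformity_of_bornology S = [set E | exists A eps,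
    [/\ S A, 0 < eps & bornology_entourage A eps `<=` E]].
Proof.
move=> bS [x _]; rewrite uniformity_of_bornologyE//.
apply/seteqP; split => E; last by right.
move=> [->|//]; have : [set: X] x by [].
by rewrite -(bornology_cover bS) => -[A SA _]; exists A, 1.
Qed.

Local Lemma uniformity_diagonal S : bornology S ->
  forall E, uniformity_of_bornology S E -> diagonal `<=` E.
Proof.
move=> bS E; rewrite uniformity_of_bornologyE// => -[->//|[A [e [SA e0 AE]]]].
move=> [B C] /diagonalP ->; apply: AE; apply: (entourage_lt e0) => x _ /=.
by rewrite subrr normr0.
Qed.

Local Lemma uniformity_inv S : bornology S ->
  forall E, uniformity_of_bornology S E ->
    uniformity_of_bornology S (E^-1)%relation.
Proof.
move=> bS E; rewrite !uniformity_of_bornologyE//.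
move=> -[->|[A [e [SA e0 AE]]]]; first by left; apply/seteqP; split.
right; exists A, e; split => // -[B C] h; apply: AE.
rewrite /bornology_entourage /= in h *.
by under eq_fun do rewrite distrC.
Qed.

Local Lemma uniformity_split S : bornology S ->
  forall E, uniformity_of_bornology S E ->
    exists2 F, uniformity_of_bornology S F & (F \; F `<=` E)%relation.
Proof.
move=> bS E; rewrite !uniformity_of_bornologyE//.
move=> -[->|[A [e [SA e0 AE]]]]; first by exists setT => //; left.
have e40 : 0 < e / 2 / 2 by rewrite !divr_gt0.
exists (bornology_entourage A (e / 2 / 2)).
  by right; exists A, (e / 2 / 2); split.
move=> [B C] /= [D BD DC]; apply: AE.
apply: (@entourage_lt _ _ (e / 2)) => [|x Ax /=].
  by rewrite ltr_pdivrMr// ltr_pMr// ltr1n.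
have := ltW (entourage_le BD Ax); have := ltW (entourage_le DC Ax) => /= h1 h2.
rewrite [leRHS]splitr; apply: le_trans (lerD h2 h1).
exact: ler_distD.
Qed.

Variables (S : set (set X)) (bS : bornology S).

HB.instance Definition _ := gen_eqMixin (CLtau bS).
HB.instance Definition _ := gen_choiceMixin (CLtau bS).
HB.instance Definition _ := @isUniform.Build (CLtau bS)
  (uniformity_of_bornology S) (@smallest_filter_filter _ _)
  (uniformity_diagonal bS) (uniformity_inv bS) (uniformity_split bS).

End uniform.

Definition bornology_separable (X : topologicalType) (S : set (set X)) :=
  exists C : set (set X),
    [/\ countable C, C `<=` S & closure (\bigcup_(A in C) A) = setT].

(* [m] ranges over all the metric structures on the carrier of [T], and
   [Metric.Pack m] is that carrier with the topology of the metric. *)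
Definition submetrizable (R : realType) (T : topologicalType) :=
  exists m : Metric.axioms_ R T, @open (Metric.Pack m) `<=` @open T.

Definition Gdelta_diagonal (T : topologicalType) := Gdelta (@diagonal T).

(* Main.v *)
Require Import Defs.
From HB Require Import structures.
From mathcomp Require Import all_boot all_order all_algebra.
From mathcomp Require Import all_classical all_reals all_analysis.

(** Why the four properties are equivalent.

    If [S_0, S_1, ...] are members of the bornology with dense union, then a
    closed set [A] is determined by the values of [d(., A)] on that union, so
    the countably many, possibly infinite, pseudometrics
    [sup_(x in S_n) |d(x, A) - d(x, B)|] separate the points of [CL X].
    They are merged into the single metric [gap A B], the supremum over [n] and over [x] in [S_n] of
    [min (1 / (n + 1)) |d(x, A) - d(x, B)|].  To make it at most [e] only the
    finitely many [n] with [1 / (n + 1) > e] have to be controlled, and the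
    union of finitely many [S_n] belongs to the bornology; hence the balls of
    [gap] are neighbourhoods and its topology is coarser ([near_gap]).

    A coarser metric exhibits the diagonal as the intersection of the open sets
    [{(x, y) | m(x, y) < 1 / (n + 1)}], and each singleton [{x}] is the
    preimage of the diagonal by the continuous map [y |-> (x, y)].

    The way back uses only that the point [X] of [CL X] is a G_delta, say the
    intersection of open sets [G_n].  Each [G_n] contains every [B] whose
    distance function is close to that of [X] on some [S_n] in the bornology.
    Let [D] be the closure of the union of the [S_n]: both [d(., D)] and
    [d(., X)] vanish on every [S_n], so [D] lies in all the [G_n], whence
    [D = X].  *)

Set Implicit Arguments.
Unset Strict Implicit.
Unset Printing Implicit Defensive.

Import Order.TTheory GRing.Theory Num.Theory.

Local Open Scope classical_set_scope.
Local Open Scope ring_scope.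

(** * Submetrizable spaces and G_delta sets *)

Lemma Gdelta_preimage (T U : topologicalType) (f : T -> U) (G : set U) :
  continuous f -> Gdelta G -> Gdelta (f @^-1` G).
Proof.
move=> cf [F oF ->]; exists (fun n => f @^-1` F n).
  by move=> n; apply: open_comp => // x _; exact: cf.
by rewrite preimage_bigcap.
Qed.

Lemma Gdelta_diagonal_set1 (T : topologicalType) :
  Gdelta_diagonal T -> forall x : T, Gdelta [set x].
Proof.
move=> GT x; have -> : [set x] = pair x @^-1` diagonal.
  by apply/seteqP; split => y /=; rewrite /diagonal /= => ->.
apply: Gdelta_preimage GT => y.
by apply: cvg_pair; [exact: cvg_cst | exact: cvg_id].
Qed.

Section metric_of_distance.
Context {R : realType} {T : choiceType} {d : T -> T -> R}.
Hypotheses (dxx : forall x, d x x = 0)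
  (d_positivity : forall x y, d x y = 0 -> x = y)
  (d_sym : forall x y, d x y = d y x)
  (d_triangle : forall y x z, d x z <= d x y + d y z).

(** A copy of [T] that depends on the axioms of [d], so that the metric
    structure attached to it can neither clash with nor be inferred in place of
    another structure carried by [T]. *)
Definition metric_carrier (_ : forall x, d x x = 0)
  (_ : forall x y, d x y = 0 -> x = y)
  (_ : forall x y, d x y = d y x)
  (_ : forall y x z, d x z <= d x y + d y z) : Type := T.

Local Notation M := (metric_carrier dxx d_positivity d_sym d_triangle).
HB.instance Definition _ := Choice.copy M T.
HB.instance Definition _ := @isMetric.Build R M d dxx d_positivity d_sym
  d_triangle.

Lemma metric_of_distance :
  exists m : Metric.axioms_ R T, @mdist R (Metric.Pack m) = d.
Proof. by exists (Metric.class M). Qed.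

End metric_of_distance.

Section submetrizable.
Context {R : realType} {T : topologicalType}.

(** The sets [d x y < 1 / (n + 1)] are open already for the product of the
    given topology: moving both coordinates by less than half of the slack
    [1 / (n + 1) - d x y] keeps the inequality. *)
Lemma submetrizable_Gdelta_diagonal :
  submetrizable R T -> Gdelta_diagonal T.
Proof.
move=> [m mT]; pose M := Metric.Pack m; pose d := @mdist R M.
have near_d (x : T) e : 0 < e -> nbhs x [set y | d x y < e].
  move=> e0; have : nbhs (x : M) [set y | d x y < e].
    by rewrite -[X in nbhs _ X]ballEmdist; exact: nbhsx_ballx.
  rewrite (@nbhsE M) => -[U [oU Ux] Ud].
  by apply: filterS Ud _; apply: open_nbhs_nbhs; split => //; exact: mT.
exists (fun n => [set p : T * T | d p.1 p.2 < n.+1%:R^-1]); last first.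
  apply/seteqP; split => [[x y] /diagonalP <- n _ /=|[x y] xy].
    by rewrite /d (@mdistxx R M) invr_gt0 ltr0n.
  apply/diagonalP; apply: (@mdist_positivity R M).
  apply/eqP; rewrite eq_le mdist_ge0 andbT; apply/ler_addgt0Pr => e e0.
  have [N _ /(_ N (leqnn N)) Ne] := near_infty_natSinv_lt (PosNum e0).
  by rewrite add0r; apply/ltW/(lt_trans _ Ne)/(xy N).
move=> n; rewrite openE => -[x y] /= xyn.
set r := n.+1%:R^-1 in xyn *; pose e := (r - d x y) / 2.
have e0 : 0 < e by rewrite divr_gt0// subr_gt0.
exists ([set x' | d x x' < e], [set y' | d y y' < e]) => /=.
  by split; exact: near_d.
move=> [x' y'] /= [xx' yy'].
have -> : r = e + d x y + e by rewrite addrAC -splitr subrK.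
apply: le_lt_trans (@metric_triangle R M x' y y') _; apply: ltrD => //.
apply: le_lt_trans (@metric_triangle R M x' x y) _.
by rewrite ltrD2r metric_sym.
Qed.

(** It is enough that the balls of [d] are neighbourhoods of their centers:
    this says that the identity is continuous towards the metric topology. *)
Lemma submetrizable_of_distance (d : T -> T -> R) :
  (forall x, d x x = 0) -> (forall x y, d x y = 0 -> x = y) ->
  (forall x y, d x y = d y x) ->
  (forall y x z, d x z <= d x y + d y z) ->
  (forall (x : T) e, 0 < e -> nbhs x [set y | d x y < e]) ->
  submetrizable R T.
Proof.
move=> dxx d_pos d_sym d_tri near_d.
have [m md] := metric_of_distance dxx d_pos d_sym d_tri.
exists m; pose M := Metric.Pack m => U oU; rewrite openE => x Ux.
have /nbhs_ballP[e e0 eU] : nbhs (x : M) U by exact: open_nbhs_nbhs.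
by apply: filterS (near_d x e e0); rewrite ballEmdist md in eU.
Qed.

End submetrizable.

(** * The distance to a set *)

Section dist_set.
Context {R : realType} {X : metricType R}.
Implicit Types (x a : X) (A B : set X).

Let dist_lbound x A : lbound [set mdist x a | a in A] 0.
Proof. by move=> _ [a _ <-]; exact: mdist_ge0. Qed.

Lemma dist_set_le x a A : A a -> dist_set x A <= mdist x a.
Proof.
move=> Aa; apply: ge_inf; last by exists a.
by exists 0; exact: dist_lbound.
Qed.

Lemma dist_set_lt x A e : A !=set0 -> dist_set x A < e ->
  exists2 a, A a & mdist x a < e.
Proof.
move=> [a Aa] /inf_lt[|_ [b Ab <-] be]; last by exists b.
by exists (mdist x a), a.
Qed.

Lemma dist_set0 x A : A x -> dist_set x A = 0.
Proof.
move=> Ax; apply/eqP; rewrite eq_le; apply/andP; split.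
  by rewrite -(mdistxx x) dist_set_le.
by apply: lb_le_inf; [exists (mdist x x), x | exact: dist_lbound].
Qed.

(** A point [a] of [A] is close to some [x] in [D]; then [dist_set x A], which
    is [dist_set x B], is small, so that [B] has a point close to [x] and hence
    to [a]. *)
Lemma dist_set_dense_subset (D A B : set X) :
  closure D = setT -> closed B -> B !=set0 ->
  (forall x, D x -> dist_set x A = dist_set x B) -> A `<=` B.
Proof.
move=> dD cB B0 AB a Aa; apply: cB => U /nbhs_ballP[e /= e0 eU].
have e20 : 0 < e / 2 by rewrite divr_gt0.
have [x [Dx]] : D `&` ball a (e / 2) !=set0.
  by have : closure D a; [rewrite dD|apply; exact: nbhsx_ballx].
rewrite ballEmdist /= => ax.
have [|b Bb xb] := @dist_set_lt x B (e / 2) B0.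
  rewrite -AB//; apply: le_lt_trans ax.
  by rewrite metric_sym dist_set_le.
exists b; split => //; apply: eU; rewrite ballEmdist /=.
by apply: le_lt_trans (metric_triangle a x b) _; rewrite [ltRHS]splitr ltrD.
Qed.

End dist_set.

Lemma CL_eq (X : topologicalType) (A B : CL X) : A = B :> set X -> A = B.
Proof.
case: A B => [A A0 cA] [B B0 cB] /= AB; subst B.
by rewrite (Prop_irrelevance A0 B0) (Prop_irrelevance cA cB).
Qed.

(** * A metric on closed sets from a sequence of sets *)

Section gap.
Context {R : realType} {X : metricType R}.
Variable F : nat -> set X.
Hypothesis F0 : F 0%N !=set0.
Implicit Types A B C : CL X.

(** The cap [1 / (n + 1)] keeps the supremum finite, although the differences
    of distances may be unbounded on [F n], and makes all but finitely many [n]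
    irrelevant at any given scale. *)
Definition gap A B : R :=
  sup [set Num.min p.1.+1%:R^-1 `|dist_set p.2 A - dist_set p.2 B| |
       p in [set p : nat * X | F p.1 p.2]].

Lemma gap_ge n x A B : F n x ->
  Num.min n.+1%:R^-1 `|dist_set x A - dist_set x B| <= gap A B.
Proof.
move=> Fx; apply: ub_le_sup; last by exists (n, x).
exists 1 => _ [[k y] _ <-] /=.
by rewrite ge_min invf_le1 ?ltr0n// ler1n.
Qed.

Lemma gap_le A B e :
  (forall n x, F n x ->
    Num.min n.+1%:R^-1 `|dist_set x A - dist_set x B| <= e) ->
  gap A B <= e.
Proof.
move=> h; apply: ge_sup; last by move=> _ [[n x] Fx <-]; exact: h.
by have [x Fx] := F0; eexists; exists (0%N, x).
Qed.

Lemma gap_ge0 A B : 0 <= gap A B.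
Proof.
have [x Fx] := F0; apply: le_trans (gap_ge A B Fx).
by rewrite le_min normr_ge0 invr_ge0 ler0n.
Qed.

Lemma gapxx A : gap A A = 0.
Proof.
apply/eqP; rewrite eq_le gap_ge0 andbT; apply: gap_le => n x _.
by rewrite subrr normr0 ge_min lexx orbT.
Qed.

Lemma gap_sym A B : gap A B = gap B A.
Proof. by congr sup; apply: eq_imagel => p _; rewrite distrC. Qed.

Lemma gap_triangle B A C : gap A C <= gap A B + gap B C.
Proof.
apply: gap_le => n x Fx.
apply: le_trans (lerD (gap_ge A B Fx) (gap_ge B C Fx)).
have := ler_distD (dist_set x B) (dist_set x A) (dist_set x C).
set a := `|_ - dist_set x C|; set b := `|_ - dist_set x B|.
set c := `|_ - _| => abc; have b0 : 0 <= b := normr_ge0 _.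
have c0 : 0 <= c := normr_ge0 _.
have r0 : 0 <= n.+1%:R^-1 :> R by rewrite invr_ge0 ler0n.
rewrite ge_min; have [rb|rb] := leP n.+1%:R^-1 b.
  by rewrite lerDl le_min r0 c0.
have [rc|rc] := leP n.+1%:R^-1 c; first by rewrite lerDr b0.
by rewrite abc orbT.
Qed.

Lemma gap_positivity A B : closure (\bigcup_n F n) = setT ->
  gap A B = 0 -> A = B.
Proof.
move=> dF AB.
have eqd x : (\bigcup_n F n) x -> dist_set x A = dist_set x B.
  move=> [n _ Fx]; have := gap_ge A B Fx.
  by rewrite AB ge_min leNgt invr_gt0 ltr0n /= normr_le0 subr_eq0 => /eqP.
apply: CL_eq; apply/seteqP; split.
  exact: (dist_set_dense_subset dF (@CL_closed _ B) (@CL_nonempty _ B)).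
apply: (dist_set_dense_subset dF (@CL_closed _ A) (@CL_nonempty _ A)).
by move=> x xF; rewrite eqd.
Qed.

(** With [1 / (n + 1) < e / 2] for all [n >= N], the cap takes care of the
    indices from [N] on, and the entourage of a member of the bornology that
    contains [F 0, ..., F (N - 1)] takes care of the others. *)
Lemma near_gap (S : set (set X)) (bS : bornology S) (A : CLtau bS) e :
  (forall n, S (F n)) -> 0 < e -> nbhs A [set B | gap A B < e].
Proof.
move=> SF e0; have e20 : 0 < e / 2 by rewrite divr_gt0.
have [N _ Ne] := near_infty_natSinv_lt (PosNum e20).
have [P SP FP] : exists2 P, S P & forall n, (n < N)%N -> F n `<=` P.
  (* [F 0] serves for [N = 0], since the empty set is not in a bornology. *)
  elim: N {Ne} => [|N [P SP FP]]; first by exists (F 0%N).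
  exists (P `|` F N); first exact: bornology_setU.
  move=> n; rewrite ltnS leq_eqVlt => /orP[/eqP ->|/FP nP].
    exact: subsetUr.
  by apply: subset_trans nP _; exact: subsetUl.
apply/nbhsP; exists (bornology_entourage P (e / 2)).
  by apply: sub_gen_smallest; exists P, (e / 2).
move=> B /=; rewrite /xsection /= inE => h; rewrite /= in h *.
apply: (@le_lt_trans _ _ (e / 2)); last by rewrite ltr_pdivrMr// ltr_pMr// ltr1n.
apply: gap_le => n x Fx; rewrite ge_min.
have [nN|Nn] := ltnP n N.
  by apply/orP; right; apply/ltW/(Defs.entourage_le h)/(FP n).
by rewrite (ltW (Ne n Nn)).
Qed.

End gap.

(** * The equivalence *)

Section bornology_separable.
Context {R : realType} {X : metricType R} {S : set (set X)}.
Variable bS : bornology S.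

Lemma bornology_separable_submetrizable :
  bornology_separable S -> submetrizable R (CLtau bS).
Proof.
move=> [C [/pfcard_geP[C0|[f]] CS dC]].
  (* An empty [C] can only have a dense union if [X], hence [CL X], is empty. *)
  have X0 : [set: X] = set0 by rewrite -dC C0 bigcup_set0 closure0.
  have noA (A : CLtau bS) : False.
    by have [x _] := CL_nonempty A; have : [set: X] x by []; rewrite X0.
  by apply: (@submetrizable_of_distance _ _ (fun _ _ => 0)) => // A; case: (noA A).
have SF n : S (f n) by apply: CS; exact: funS.
have dF : closure (\bigcup_n f n) = setT.
  rewrite -dC; congr closure; apply/seteqP; split => [x [n _ fx]|x [A CA Ax]].
    by exists (f n) => //; exact: funS.
  by have [n _ fA] := 'surj_f CA; exists n => //; rewrite fA.
have F0 := bornology_nonempty bS (SF 0%N).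
apply: (@submetrizable_of_distance R (CLtau bS) (@gap R X f)).
- exact: gapxx.
- by move=> A B; exact: gap_positivity.
- exact: gap_sym.
- exact: gap_triangle.
- by move=> A e; exact: near_gap.
Qed.

(** The G_delta property is used at the point [X] only. Every closed set whose
    distance function vanishes on the chosen members of the bornology belongs
    to [{X}], in particular the closure of their union. *)
Lemma Gdelta_set1_bornology_separable :
  (forall A : CLtau bS, Gdelta [set A]) -> bornology_separable S.
Proof.
move=> GA; have [X0|X0] := pselect ([set: X] !=set0); last first.
  exists set0; split => //; apply/seteqP; split => // x _.
  by case: X0; exists x.
pose XX : CLtau bS := Build_CL X0 closedT.
have [G oG GE] := GA XX.
have /choice[F FP] n : exists A, S A /\
    exists2 e, 0 < e & forall B : CLtau bS,
      bornology_entourage A e (XX, B) -> G n B.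
  have : nbhs XX (G n).
    apply: open_nbhs_nbhs; split; first exact: oG.
    by have : [set XX] XX by []; rewrite GE; exact.
  move=> /nbhsP[E]; rewrite /entourage /=.
  rewrite (uniformity_of_bornologyP bS X0) => -[A [e [SA e0 AE]]] EG.
  exists A; split => //; exists e => // B AB; apply: EG.
  by rewrite /xsection /= inE; exact: AE.
exists (range F); split.
- exact: card_image_le.
- by move=> _ [n _ <-]; exact: (FP n).1.
have D0 : closure (\bigcup_(A in range F) A) !=set0.
  have [x Fx] := bornology_nonempty bS (FP 0%N).1.
  by exists x; apply: subset_closure; exists (F 0%N) => //; exists 0%N.
pose D : CLtau bS := Build_CL D0 (@closed_closure _ _).
suff GD : [set XX] D by exact: (congr1 (@CL_set X) (GD : D = XX :> CL X)).
rewrite GE => n _; have [_ [e e0]] := FP n; apply.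
apply: (Defs.entourage_lt e0) => x Fx /=.
rewrite !dist_set0 ?subrr ?normr0//; apply: subset_closure.
by exists (F n) => //; exists n.
Qed.

End bornology_separable.

Theorem theorem4p12 (R : realType) (X : metricType R) (S : set (set X))
    (bS : bornology S) :
  [<-> bornology_separable S;
       submetrizable R (CLtau bS);
       Gdelta_diagonal (CLtau bS);
       forall A : CLtau bS, Gdelta [set A]].
Proof.
tfae.
- exact: bornology_separable_submetrizable.
- exact: submetrizable_Gdelta_diagonal.
- exact: Gdelta_diagonal_set1.
- exact: Gdelta_set1_bornology_separable.
Qed.
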